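(* Let $\widehat{\mathfrak{stl}}_3(R)=\mathcal U\oplus\mathfrak{stl}_3(R)$ with bracket $[(c,x),(c',y)]=(\psi(x,y),[x,y])$ and let $\pi$ be the projection onto $\mathfrak{stl}_3(R)$. Then $(\widehat{\mathfrak{stl}}_3(R),\pi)$ is the universal central extension of $\mathfrak{stl}_3(R)$ in the category of Leibniz algebras over $K$, and hence $HL_2(\mathfrak{stl}_3(R))\cong\mathcal U=R_3^6$.
   Context: $K$ unital commutative ring, $R$ unital associative $K$-algebra, free as $K$-module with basis containing $1$. Leibniz algebra: $K$-bilinear bracket with $[x,[y,z]]=[[x,y],z]-[[x,z],y]$. A central extension of a Leibniz algebra $L$ is a surjective homomorphism $\pi:\hat L\to L$ with central kernel that splits as a $K$-module map; it is universal if for every central extension $\tau:\tilde L\to L$ there is a unique homomorphism $\eta:\hat L\to\tilde L$ with $\tau\circ\eta=\pi$. $HL_2(L)$ is the second homology of the Leibniz complex $(L^{\otimes n},\delta)$, $\delta(x_1\otimes\cdots\otimes x_n)=\sum_{1\le i<j\le n}(-1)^{j+1}x_1\otimes\cdots\otimes x_{i-1}\otimes[x_i,x_j]\otimes x_{i+1}\otimes\cdots\widehat{x_j}\cdots\otimes x_n$. $\mathfrak{stl}_3(R)$: Leibniz algebra over $K$ generated by $X_{ij}(a)$, $a\in R$, $1\le i\ne j\le 3$, subject to $K$-linearity in $a$, $[X_{ij}(a),X_{jk}(b)]=X_{ik}(ab)$ and $[X_{ij}(a),X_{ki}(b)]=-X_{kj}(ba)$ for distinct $i,j,k$, $[X_{ij}(a),X_{kl}(b)]=0$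 for $j\ne k$, $i\ne l$. $H$ is the $K$-span of all $[X_{ij}(a),X_{ji}(b)]$; $\mathfrak{stl}_3(R)=H\oplus\bigoplus_{i\ne j}X_{ij}(R)$ with $a\mapsto X_{ij}(a)$ injective. $R_3=R/(3R+R[R,R])$, $\bar a$ the class of $a$. $\mathcal U=R_3^6$ with coordinates indexed by $\{1,2,3,-1,-2,-3\}$; $\bar a^{(m)}$ is the element with coordinate $\bar a$ at index $m$, $0$ elsewhere. $\mathrm{sign}(m,n)=1$ if $m<n$, $-1$ if $m>n$. $\psi$ is the $K$-bilinear map with $\psi(X_{ij}(a),X_{ik}(b))=\mathrm{sign}(j,k)(\overline{ab})^{(i)}$, $\psi(X_{ij}(a),X_{kj}(b))=\mathrm{sign}(i,k)(\overline{ab})^{(-j)}$ for distinct $i,j,k$, $\psi=0$ on all other pairs $X_{ij}(a),X_{kl}(b)$ and whenever an argument lies in $H$. *)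

(* Defs.v *)
From HB Require Import structures.
From mathcomp Require Import all_boot all_order all_algebra.
Set Implicit Arguments. Unset Strict Implicit. Unset Printing Implicit Defensive.
Import GRing.Theory.
Local Open Scope ring_scope.

Section LeibnizDefs.
Variable K : comPzRingType.

Definition bilin (U V W : lmodType K) (f : U -> V -> W) : Prop :=
  (forall (a : K) (x x' : U) (y : V), f (a *: x + x') y = a *: f x y + f x' y) /\
  (forall (a : K) (x : U) (y y' : V), f x (a *: y + y') = a *: f x y + f x y').

Definition klinear (U V : lmodType K) (f : U -> V) : Prop :=
  forall (a : K) (x y : U), f (a *: x + y) = a *: f x + f y.

Definition leibniz (V : lmodType K) (br : V -> V -> V) : Prop :=
  bilin br /\
  forall x y z : V, br x (br y z) = br (br x y) z - br (br x z) y.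

Definition lhom (V W : lmodType K) (brV : V -> V -> V) (brW : W -> W -> W)
  (f : V -> W) : Prop :=
  klinear f /\ forall x y : V, f (brV x y) = brW (f x) (f y).

Definition central_ext (L : lmodType K) (brL : L -> L -> L)
  (E : lmodType K) (brE : E -> E -> E) (p : E -> L) : Prop :=
  [/\ leibniz brE, lhom brE brL p,
      (forall x : L, exists z : E, p z = x),
      (forall z : E, p z = 0 -> forall x : E, brE z x = 0 /\ brE x z = 0) &
      exists s : L -> E, klinear s /\ forall x : L, p (s x) = x].

Definition universal_central_ext (L : lmodType K) (brL : L -> L -> L)
  (E : lmodType K) (brE : E -> E -> E) (p : E -> L) : Prop :=
  central_ext brL brE p /\
  forall (M : lmodType K) (brM : M -> M -> M) (t : M -> L),
    central_ext brL brM t ->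
    exists eta : E -> M,
      [/\ lhom brE brM eta, (forall z : E, t (eta z) = p z) &
          forall eta' : E -> M, lhom brE brM eta' ->
            (forall z : E, t (eta' z) = p z) -> forall z : E, eta' z = eta z].

(* An element of L (x) L (tensor product over K) is represented by a finite
   formal sum  sum_i x_i (x) y_i,  i.e. a sequence of pairs.  Two such
   representatives denote the same tensor iff every K-bilinear map out of
   L x L takes the same value on them (universal property of L (x)_K L). *)
Definition tensor_eq (L : lmodType K) (s s' : seq (L * L)) : Prop :=
  forall (M : lmodType K) (beta : L -> L -> M), bilin beta ->
    \sum_(q <- s) beta q.1 q.2 = \sum_(q <- s') beta q.1 q.2.

Definition delta2 (L : lmodType K) (br : L -> L -> L) (s : seq (L * L)) : L :=
  \sum_(q <- s) - br q.1 q.2.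

Definition delta3 (L : lmodType K) (br : L -> L -> L) (w : seq (L * L * L))
  : seq (L * L) :=
  flatten [seq [:: (- br q.1.1 q.1.2, q.2); (br q.1.1 q.2, q.1.2);
                   (q.1.1, br q.1.2 q.2)] | q <- w].

(* HL_2(L) = ker delta2 / im delta3 is isomorphic, as a K-module, to U:
   there is a map phi on 2-cycles, well defined on tensors, K-linear,
   surjective onto U, whose kernel is exactly the 2-boundaries. *)
Definition HL2_iso (L : lmodType K) (br : L -> L -> L) (U : lmodType K) : Prop :=
  exists phi : seq (L * L) -> U,
    let cyc s := delta2 br s = 0 in
    [/\ (forall s s', cyc s -> cyc s' -> tensor_eq s s' -> phi s = phi s'),
        (forall s s', cyc s -> cyc s' -> phi (s ++ s') = phi s + phi s'),
        (forall (a : K) s, cyc s ->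
            phi [seq (a *: q.1, q.2) | q <- s] = a *: phi s),
        (forall u : U, exists s, cyc s /\ phi s = u) &
        (forall s, cyc s ->
           (phi s = 0 <-> exists w : seq (L * L * L), tensor_eq s (delta3 br w)))].

Definition free_with_one (R : algType K) : Prop :=
  exists B : R -> Prop,
    [/\ B 1,
        (forall x : R, exists s : seq (K * R),
            (forall q, q \in s -> B q.2) /\ x = \sum_(q <- s) q.1 *: q.2) &
        (forall s : seq (K * R), uniq [seq q.2 | q <- s] ->
            (forall q, q \in s -> B q.2) ->
            \sum_(q <- s) q.1 *: q.2 = 0 -> forall q, q \in s -> q.1 = 0)].

Definition is_R3_quotient (R : algType K) (R3 : lmodType K) (bar : R -> R3) : Prop :=
  [/\ klinear bar,
      (forall y : R3, exists x : R, bar x = y) &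
      (forall x : R, bar x = 0 <->
         exists (r : R) (s : seq (R * R * R)),
           x = 3%:R * r + \sum_(q <- s) q.1.1 * (q.1.2 * q.2 - q.2 * q.1.2))].

(* Indices 1,2,3 of the paper are 0,1,2 : 'I_3. *)
Definition stl3_rels (R : algType K) (M : lmodType K) (brM : M -> M -> M)
  (Y : 'I_3 -> 'I_3 -> R -> M) : Prop :=
  [/\ (forall i j : 'I_3, i != j -> klinear (Y i j)),
      (forall (i j k : 'I_3) (a b : R), i != j -> j != k -> i != k ->
          brM (Y i j a) (Y j k b) = Y i k (a * b)),
      (forall (i j k : 'I_3) (a b : R), i != j -> j != k -> i != k ->
          brM (Y i j a) (Y k i b) = - Y k j (b * a)) &
      (forall (i j k l : 'I_3) (a b : R), i != j -> k != l ->
          j != k -> i != l -> brM (Y i j a) (Y k l b) = 0)].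

(* (L, brL, X) is the Leibniz algebra over K presented by generators X_ij(a)
   and the Steinberg relations, i.e. stl_3(R) (characterized up to unique
   isomorphism by its universal property). *)
Definition is_stl3 (R : algType K) (L : lmodType K) (brL : L -> L -> L)
  (X : 'I_3 -> 'I_3 -> R -> L) : Prop :=
  [/\ leibniz brL, stl3_rels brL X &
      forall (M : lmodType K) (brM : M -> M -> M) (Y : 'I_3 -> 'I_3 -> R -> M),
        leibniz brM -> stl3_rels brM Y ->
        exists f : L -> M,
          [/\ lhom brL brM f,
              (forall (i j : 'I_3) (a : R), i != j -> f (X i j a) = Y i j a) &
              forall f' : L -> M, lhom brL brM f' ->
                (forall (i j : 'I_3) (a : R), i != j -> f' (X i j a) = Y i j a) ->
                forall x : L, f' x = f x]].

(* Coordinates of U are indexed by {1,2,3,-1,-2,-3}: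
   inl i stands for index i+1, inr j stands for index -(j+1). *)
Definition Ucoord := ('I_3 + 'I_3)%type.
Definition Umod (R3 : lmodType K) := {ffun Ucoord -> R3}.

Definition uvec (R3 : lmodType K) (m : Ucoord) (c : R3) : Umod R3 :=
  [ffun m' => if m' == m then c else 0].

Definition sgn (m n : 'I_3) : K := if (m < n)%N then 1 else -1.

Definition psi_spec (R : algType K) (L : lmodType K) (brL : L -> L -> L)
  (X : 'I_3 -> 'I_3 -> R -> L) (R3 : lmodType K) (bar : R -> R3)
  (psi : L -> L -> Umod R3) : Prop :=
  [/\ bilin psi,
      (forall (i j k : 'I_3) (a b : R), i != j -> j != k -> i != k ->
         psi (X i j a) (X i k b) = sgn j k *: uvec (inl i) (bar (a * b))),
      (forall (i j k : 'I_3) (a b : R), i != j -> j != k -> i != k ->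
         psi (X i j a) (X k j b) = sgn i k *: uvec (inr j) (bar (a * b))),
      (forall (i j k l : 'I_3) (a b : R), i != j -> k != l ->
         ~~ ((i == k) && (j != l)) -> ~~ ((j == l) && (i != k)) ->
         psi (X i j a) (X k l b) = 0) &
      (* psi vanishes when an argument lies in H = span [X_ij(a), X_ji(b)] *)
      (forall (i j : 'I_3) (a b : R) (y : L), i != j ->
         psi (brL (X i j a) (X j i b)) y = 0 /\
         psi y (brL (X i j a) (X j i b)) = 0)].

Definition ext_bracket (L U : lmodType K) (brL : L -> L -> L) (psi : L -> L -> U)
  (p q : U * L) : U * L := (psi p.2 q.2, brL p.2 q.2).

End LeibnizDefs.

(* Main.v *)
(* Write h = [X_ij(a), X_ji(b)]; by the Leibniz identity it acts on X_kl(c) as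
   commutation with the matrix a b E_ii - b a E_jj does. Hence stl_3(R) is spanned
   by the X_ij(a) and the h's, and the cocycle identity for psi only has to be
   checked on these; 3 = 0 and commutativity in R_3 are what make it hold.

   Conversely, let f be any 2-cocycle of stl_3(R) with values in M. The cocycle
   identity forces f(X_ij(a), X_ik(b)) and f(X_ij(a), X_kj(b)) to depend only on ab,
   to be antisymmetric in the two roots, and to factor through R_3, so they are
   those of al o psi for a linear map al : U -> M. After subtracting al o psi, the elements
   [(0, X_ik(a)), (0, X_kj(1))] of the extension M + stl_3(R) satisfy the Steinberg
   relations, so the presentation yields a section and the difference is a
   coboundary: f(x, y) = al(psi(x, y)) + g([x, y]). For f the cocycle of a central
   extension this gives the universal property; for f the tautological cocycle
   with values in (L (x) L) / im delta_3 it identifies HL_2 with U. *)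
Require Import Defs.
From HB Require Import structures.
From mathcomp Require Import all_boot all_order all_algebra.
From mathcomp Require Import generic_quotient boolp.
Import GRing.Theory.
Local Open Scope ring_scope.
Local Open Scope quotient_scope.
Set Implicit Arguments. Unset Strict Implicit. Unset Printing Implicit Defensive.

(** * Bilinear maps, cocycles and submodules *)

Section Bilinear.
Variable K : comPzRingType.

Section Linear.
Variables (U V : lmodType K).

Lemma klinear0 (f : U -> V) : klinear f -> f 0 = 0.
Proof.
by move=> hf; have := hf (-1) 0 0; rewrite scaler0 addr0 scaleN1r addNr.
Qed.

Lemma klinearZ (f : U -> V) : klinear f -> forall a x, f (a *: x) = a *: f x.
Proof. by move=> hf a x; rewrite -[a *: x]addr0 hf klinear0 // addr0. Qed.

Lemma klinearD (f : U -> V) : klinear f -> {morph f : x y / x + y}.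
Proof. by move=> hf x y; rewrite -[x in LHS]scale1r hf scale1r. Qed.

Lemma klinearN (f : U -> V) : klinear f -> {morph f : x / - x}.
Proof. by move=> hf x; rewrite -!scaleN1r klinearZ. Qed.

Lemma klinearB (f : U -> V) : klinear f -> {morph f : x y / x - y}.
Proof. by move=> hf x y; rewrite klinearD // klinearN. Qed.

End Linear.

Section Maps.
Variables (U V W : lmodType K) (f : U -> V -> W).
Hypothesis hf : bilin f.

Lemma bilin_l y : klinear (f^~ y). Proof. by move=> a x x'; apply: hf.1. Qed.
Lemma bilin_r x : klinear (f x). Proof. by move=> a y y'; apply: hf.2. Qed.

Lemma bilin0l y : f 0 y = 0. Proof. exact: klinear0 (bilin_l y). Qed.
Lemma bilin0r x : f x 0 = 0. Proof. exact: klinear0 (bilin_r x). Qed.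
Lemma bilinNl x y : f (- x) y = - f x y. Proof. exact: klinearN (bilin_l y) x. Qed.
Lemma bilinNr x y : f x (- y) = - f x y. Proof. exact: klinearN (bilin_r x) y. Qed.
Lemma bilinDl x x' y : f (x + x') y = f x y + f x' y.
Proof. exact: klinearD (bilin_l y) x x'. Qed.
Lemma bilinDr x y y' : f x (y + y') = f x y + f x y'.
Proof. exact: klinearD (bilin_r x) y y'. Qed.
Lemma bilinZl a x y : f (a *: x) y = a *: f x y.
Proof. exact: klinearZ (bilin_l y) a x. Qed.

End Maps.

Definition cocycle (L M : lmodType K) (br : L -> L -> L) (f : L -> L -> M) :=
  bilin f /\ forall x y z, f x (br y z) = f (br x y) z - f (br x z) y.

Lemma ext_leibniz (L M : lmodType K) (br : L -> L -> L) (f : L -> L -> M) :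
  leibniz br -> cocycle br f -> leibniz (ext_bracket br f).
Proof.
move=> [hb hj] [hf hc]; split.
  by split=> a [u x] [u' x'] [v y]; rewrite /ext_bracket /= !(hb.1, hb.2, hf.1, hf.2).
by move=> [u x] [v y] [w z]; rewrite /ext_bracket /= hc hj.
Qed.

End Bilinear.

(** * Submodules as modules in their own right *)

Section SubModule.
Variables (K : comPzRingType) (L : lmodType K) (P : L -> Prop).
Hypothesis P0 : P 0.
Hypothesis Plin : forall (a : K) x y, P x -> P y -> P (a *: x + y).

(** Deciding [P] classically gives a boolean predicate, to which the subtype and submodule
    structures apply. *)
Definition submod_pred : {pred L} := fun x => `[< P x >].

Lemma submod_predP : submod_closed submod_pred.
Proof.
split; first exact/asboolP.
by move=> a x y /asboolP Px /asboolP Py; apply/asboolP/Plin.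
Qed.

HB.instance Definition _ := GRing.isSubmodClosed.Build K L submod_pred submod_predP.

Record submod := Submod { submod_val : L; _ : submod_val \in submod_pred }.
HB.instance Definition _ := [isSub for submod_val].
HB.instance Definition _ := [Choice of submod by <:].
HB.instance Definition _ := [SubChoice_isSubLmodule of submod by <:].
Definition submod_lmod : lmodType K := submod.

Lemma submod_val_linear : klinear (submod_val : submod_lmod -> L).
Proof. exact: (linearP (val : submod -> L)). Qed.

End SubModule.

(** * The Steinberg relations *)

Lemma ord3_cases (i j m k : 'I_3) :
  i != j -> j != m -> i != m -> [\/ k = i, k = j | k = m].
Proof.
move: i j m k; do 4![case=> [[|[|[|?]]] ?] //]; move=> *;
  by [exact/Or31/val_inj | exact/Or32/val_inj | exact/Or33/val_inj].
Qed.

Lemma ord3_third (i j : 'I_3) : i != j -> exists m, j != m /\ i != m.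
Proof.
move: i j; do 2![case=> [[|[|[|?]]] ?] //]; move=> _;
 by [exists (inord 0); rewrite -!val_eqE /= !inordK |
     exists (inord 1); rewrite -!val_eqE /= !inordK |
     exists (inord 2); rewrite -!val_eqE /= !inordK].
Qed.

(** All six roots are named by one triple [i], [j], [m], so case splits keep symbolic indices and
    each table of brackets serves every labelling. *)
Lemma root_cases (i j m : 'I_3) (P : 'I_3 -> 'I_3 -> Prop) :
  i != j -> j != m -> i != m ->
  P i j -> P j i -> P i m -> P m i -> P j m -> P m j ->
  forall k l, k != l -> P k l.
Proof.
move=> ij jm im ? ? ? ? ? ? k l.
have [->|->|->] := ord3_cases k ij jm im; have [->|->|->] := ord3_cases l ij jm im => //;
  rewrite eqxx //.
Qed.

Section Steinberg.
Variables (K : comPzRingType) (R : algType K).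

Section Relations.
Variables (L : lmodType K) (br : L -> L -> L) (X : 'I_3 -> 'I_3 -> R -> L).
Hypothesis hl : leibniz br.
Hypothesis hX : stl3_rels br X.

Let hb : bilin br := hl.1.

Lemma leibniz_l x y z : br (br x y) z = br x (br y z) + br (br x z) y.
Proof. by rewrite hl.2 subrK. Qed.

Variables (i j m : 'I_3).
Hypotheses (ij : i != j) (jm : j != m) (im : i != m).

Lemma stl3_lin : klinear (X i j).
Proof. by case: hX => h _ _ _; apply: h. Qed.

Lemma stl3_mul a b : br (X i j a) (X j m b) = X i m (a * b).
Proof. by case: hX => _ h _ _; apply: h. Qed.

Lemma stl3_mulC a b : br (X i j a) (X m i b) = - X m j (b * a).
Proof. by case: hX => _ _ h _; apply: h. Qed.

Lemma stl3_same a b : br (X i j a) (X i j b) = 0.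
Proof. by case: hX => _ _ _ h; apply: h; rewrite // eq_sym. Qed.

Lemma stl3_row a b : br (X i j a) (X i m b) = 0.
Proof. by case: hX => _ _ _ h; apply: h; rewrite // eq_sym. Qed.

Lemma stl3_col a b : br (X i j a) (X m j b) = 0.
Proof. by case: hX => _ _ _ h; apply: h; rewrite // eq_sym. Qed.

End Relations.

(* Diagonal entries of the matrix [a b E_ii - b a E_jj] by which
   [[X_ij(a), X_ji(b)]] acts. *)
Definition hdiag (A : pzRingType) (i j : 'I_3) (a b : A) (k : 'I_3) : A :=
  if k == i then a * b else if k == j then - (b * a) else 0.

Section Action.
Variables (L : lmodType K) (br : L -> L -> L) (X : 'I_3 -> 'I_3 -> R -> L).
Hypothesis hl : leibniz br.
Hypothesis hX : stl3_rels br X.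

Let hb : bilin br := hl.1.

(** On the four roots through [m], one term of the Leibniz expansion vanishes. The roots [(i, j)]
    and [(j, i)] follow from X_ij(c) = [X_im(c), X_mj(1)] and X_ji(c) = [X_jm(c), X_mi(1)]. *)
Lemma stl3_act_l i j a b k l c : i != j -> k != l ->
  br (br (X i j a) (X j i b)) (X k l c) =
  X k l (hdiag i j a b k * c - c * hdiag i j a b l).
Proof.
move=> ij; have [m [jm im]] := ord3_third ij.
have [ji mj mi] : [/\ j != i, m != j & m != i] by split; rewrite eq_sym.
pose E := (eqxx, negbTE ij, negbTE jm, negbTE im, negbTE ji, negbTE mj, negbTE mi).
have XN u v c' : u != v -> X u v (- c') = - X u v c' by move=> /(stl3_lin hX)/klinearN.
have XD u v c1 c2 : u != v -> X u v (c1 + c2) = X u v c1 + X u v c2.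
  by move=> /(stl3_lin hX)/klinearD.
have him c' : br (br (X i j a) (X j i b)) (X i m c') = X i m (a * b * c').
  by rewrite leibniz_l // (stl3_mul hX) // (stl3_row hX) // (stl3_mul hX) // (bilin0l hb)
    addr0 mulrA.
have hmi c' : br (br (X i j a) (X j i b)) (X m i c') = - X m i (c' * (a * b)).
  by rewrite leibniz_l // (stl3_col hX) // (stl3_mulC hX) // (bilin0r hb) add0r (bilinNl
    hb) (stl3_mul hX) // mulrA.
have hjm c' : br (br (X i j a) (X j i b)) (X j m c') = - X j m (b * a * c').
  by rewrite leibniz_l // (stl3_row hX) // (stl3_mul hX) // (bilin0r hb) add0r (stl3_mulC
    hX) // mulrA.
have hmj c' : br (br (X i j a) (X j i b)) (X m j c') = X m j (c' * (b * a)).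
  by rewrite leibniz_l // (stl3_col hX) // (stl3_mulC hX) // (bilin0l hb) addr0 (bilinNr
    hb) (stl3_mulC hX) // opprK mulrA.
move: k l; apply: (root_cases ij jm im); rewrite /hdiag !E ?mulr0 ?mul0r ?subr0 ?sub0r
  ?mulrN ?mulNr ?opprK ?XN ?him ?hmi ?hjm ?hmj //.
  rewrite -{1}[c]mulr1 -(stl3_mul hX im mj) // hl.2 him hmj (stl3_mul hX) // mulr1.
  by rewrite (stl3_mulC hX) // opprK mul1r XD // mulrA.
rewrite -{1}[c]mulr1 -(stl3_mul hX jm mi) // hl.2 hjm hmi (bilinNl hb) (stl3_mul hX) // mulr1.
by rewrite (bilinNl hb) opprK (stl3_mulC hX) // mul1r -opprD -XD // -XN // opprD mulrA.
Qed.

(** A Leibniz bracket need not be antisymmetric, so the right action is computed separately, in the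
    same order; right multiplication is a derivation. *)
Lemma stl3_act_r i j a b k l c : i != j -> k != l ->
  br (X k l c) (br (X i j a) (X j i b)) =
  - br (br (X i j a) (X j i b)) (X k l c).
Proof.
move=> ij; have [m [jm im]] := ord3_third ij.
have [ji mj mi] : [/\ j != i, m != j & m != i] by split; rewrite eq_sym.
pose E := (eqxx, negbTE ij, negbTE jm, negbTE im, negbTE ji, negbTE mj, negbTE mi).
have XN u v c' : u != v -> X u v (- c') = - X u v c' by move=> /(stl3_lin hX)/klinearN.
have XD u v c1 c2 : u != v -> X u v (c1 + c2) = X u v c1 + X u v c2.
  by move=> /(stl3_lin hX)/klinearD.
have him c' : br (X i m c') (br (X i j a) (X j i b)) = - X i m (a * b * c').
  rewrite hl.2 (stl3_row hX) // (bilin0l hb) sub0r (stl3_mulC hX) // (bilinNl hb) opprK.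
  by rewrite (stl3_mulC hX) // mulrA.
have hmi c' : br (X m i c') (br (X i j a) (X j i b)) = X m i (c' * (a * b)).
  rewrite hl.2 (stl3_col hX mi) // (bilin0l hb) subr0 (stl3_mul hX) //.
  by rewrite (stl3_mul hX) // mulrA.
have hjm c' : br (X j m c') (br (X i j a) (X j i b)) = X j m (b * a * c').
  rewrite hl.2 (stl3_row hX jm) // (bilin0l hb) subr0 (stl3_mulC hX) //.
  by rewrite (bilinNl hb) (stl3_mulC hX) // opprK mulrA.
have hmj c' : br (X m j c') (br (X i j a) (X j i b)) = - X m j (c' * (b * a)).
  rewrite hl.2 (stl3_col hX) // (bilin0l hb) sub0r (stl3_mul hX) //.
  by rewrite (stl3_mul hX) // mulrA.
move: k l; apply: (root_cases ij jm im);
  rewrite stl3_act_l // /hdiag !E ?mulr0 ?mul0r ?subr0 ?sub0r ?mulrN ?mulNr ?opprK ?XN ?him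
    ?hmi ?hjm ?hmj ?opprK //.
  rewrite -{1}[c]mulr1 -(stl3_mul hX im mj) // leibniz_l // hmj him (bilinNr hb) (bilinNl hb).
  by rewrite !(stl3_mul hX) // mulr1 mul1r XD // opprD addrC !mulrA.
rewrite -{1}[c]mulr1 -(stl3_mul hX jm mi) // leibniz_l // hmi hjm.
by rewrite !(stl3_mul hX) // mulr1 mul1r -XN // opprD !opprK XD // addrC !mulrA.
Qed.

End Action.
End Steinberg.

(** * Generation *)

Section Generation.
Variables (K : comPzRingType) (R : algType K).
Variables (L : lmodType K) (br : L -> L -> L) (X : 'I_3 -> 'I_3 -> R -> L).
Hypothesis hL : is_stl3 br X.

Let hl : leibniz br. Proof. by case: hL. Qed.
Let hX : stl3_rels br X. Proof. by case: hL. Qed.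
Let hb : bilin br := hl.1.

Section Induction.
Variable P : L -> Prop.
Hypothesis P0 : P 0.
Hypothesis Plin : forall (a : K) x y, P x -> P y -> P (a *: x + y).
Hypothesis PX : forall i j a, i != j -> P (X i j a).

Section Subalgebra.
Hypothesis Pbr : forall x y, P x -> P y -> P (br x y).

Let M : lmodType K := submod_lmod P0 Plin.
Let vM : M -> L := @submod_val K L P.

Let M_P (x : M) : P (vM x). Proof. by case: x => x hx; apply/asboolP. Qed.

Let M_inj : injective vM. Proof. exact: (@val_inj _ _ (submod P)). Qed.

Let M_br (x y : M) : br (vM x) (vM y) \in submod_pred P.
Proof. by apply/asboolP/Pbr; apply: M_P. Qed.

Let brM (x y : M) : M := Submod (M_br x y).

(** Membership in [P] is known only for [i != j]; the default 0 makes [Y] total, and the relations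
    only constrain distinct indices. *)
Let Y i j a : M := insubd ((0 : M) : submod P) (X i j a).

Let vY i j a : i != j -> vM (Y i j a) = X i j a.
Proof. by move=> ij; rewrite /vM val_insubd ifT //; apply/asboolP/PX. Qed.

Let vlin : klinear vM. Proof. by exact: submod_val_linear. Qed.

(** [P] cuts out a subalgebra [M] containing the generators. The presentation maps [L] to [M];
    composed with the inclusion this fixes the generators, so it is the identity by uniqueness. *)
Lemma stl3_subalg_ind x : P x.
Proof.
have vbr u v : vM (brM u v) = br (vM u) (vM v) by [].
have hM : leibniz brM.
  split=> [|u v w]; last by apply: M_inj; rewrite (klinearB vlin) !vbr hl.2.
  by split=> a u v w; apply: M_inj; rewrite vlin !vbr vlin (hb.1, hb.2).
have hY : stl3_rels brM Y.
  case: hX => h1 h2 h3 h4; split.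
  - by move=> i j ij a u v; apply: M_inj; rewrite vlin !vY ?h1.
  - by move=> i j k a b ij jk ik; apply: M_inj; rewrite vbr !vY ?h2.
  - move=> i j k a b ij jk ik; apply: M_inj; rewrite (klinearN vlin) vbr.
    by rewrite !vY ?h3 // eq_sym.
  - move=> i j k l a b *; apply: M_inj; rewrite (klinear0 vlin) vbr.
    by rewrite !vY ?h4.
case: (hL) => _ _ hU.
have [f [[flin fbr] fX _]] := hU M brM Y hM hY.
have [g [_ _ gU]] := hU L br X hl hX.
have -> : x = vM (f x).
  transitivity (g x); first by apply: gU.
  apply/esym/(gU (vM \o f)); first by split=> [a u v|u v] /=; rewrite ?flin ?vlin ?fbr.
  by move=> i j a ij /=; rewrite fX ?vY.
exact: M_P.
Qed.

End Subalgebra.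
End Induction.

Inductive stl3_span : L -> Prop :=
| Span0 : stl3_span 0
| SpanP a x y of stl3_span x & stl3_span y : stl3_span (a *: x + y)
| SpanX i j a of i != j : stl3_span (X i j a)
| SpanH i j a b of i != j : stl3_span (br (X i j a) (X j i b)).

Lemma stl3_spanN x : stl3_span x -> stl3_span (- x).
Proof. by move=> hx; rewrite -[- x]addr0 -scaleN1r; apply: SpanP => //; apply: Span0. Qed.

Lemma stl3_spanB x y : stl3_span x -> stl3_span y -> stl3_span (x - y).
Proof. by move=> hx hy; rewrite -[x]scale1r; apply: SpanP => //; apply: stl3_spanN. Qed.

Lemma stl3_spanXX i j k l a b : i != j -> k != l ->
  stl3_span (br (X i j a) (X k l b)).
Proof.
move=> ij; have [m [jm im]] := ord3_third ij.
have [ji mj mi] : [/\ j != i, m != j & m != i] by split; rewrite eq_sym.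
move: k l; apply: (root_cases ij jm im).
- by rewrite (stl3_same hX) //; apply: Span0.
- exact: SpanH.
- by rewrite (stl3_row hX) //; apply: Span0.
- by rewrite (stl3_mulC hX) //; apply/stl3_spanN/SpanX.
- by rewrite (stl3_mul hX) //; apply/SpanX.
- by rewrite (stl3_col hX) //; apply: Span0.
Qed.

Lemma stl3_span_br x y : stl3_span x -> stl3_span y -> stl3_span (br x y).
Proof.
move=> hx hy; elim: hx => [|c u v _ hu _ hv|i j a ij|i j a b ij].
- by rewrite (bilin0l hb); apply: Span0.
- by rewrite hb.1; apply: SpanP.
- elim: hy => [|c u v _ hu _ hv|k l a' kl|k l a' b' kl].
  + by rewrite (bilin0r hb); apply: Span0.
  + by rewrite hb.2; apply: SpanP.
  + exact: stl3_spanXX.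
  + by rewrite (stl3_act_r hl hX) // (stl3_act_l hl hX) //; apply/stl3_spanN/SpanX.
- elim: hy => [|c u v _ hu _ hv|k l a' kl|k l a' b' kl].
  + by rewrite (bilin0r hb); apply: Span0.
  + by rewrite hb.2; apply: SpanP.
  + by rewrite (stl3_act_l hl hX) //; apply/SpanX.
  (* Here [h, [X_kl, X_lk]] = [[h, X_kl], X_lk] - [[h, X_lk], X_kl], and the inner brackets are root
     vectors again. *)
  + have lk : l != k by rewrite eq_sym.
    by rewrite hl.2 !(stl3_act_l hl hX) //; apply: stl3_spanB; apply: stl3_spanXX.
Qed.

Lemma stl3_spanned x : stl3_span x.
Proof.
apply: stl3_subalg_ind; [exact: Span0|exact: SpanP|exact: SpanX|exact: stl3_span_br].
Qed.

(** [L] is perfect, since X_ij(a) = [X_im(a), X_mj(1)]. *)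
Lemma stl3_perfect (M : lmodType K) (d : L -> M) :
  klinear d -> (forall x y, d (br x y) = 0) -> forall x, d x = 0.
Proof.
move=> hd d0 x; elim: (stl3_spanned x) => [|c u v _ du _ dv|i j a ij|i j a b ij].
- exact: klinear0.
- by rewrite hd du dv scaler0 addr0.
- have [m [jm im]] := ord3_third ij; have mj : m != j by rewrite eq_sym.
  by rewrite -[a]mulr1 -(stl3_mul hX im mj ij).
- exact: d0.
Qed.

End Generation.

(** * The cocycle psi *)

(** The identity is linear in each argument, so nested inductions over the span, innermost on the
    third argument, reduce it to generators. *)
Lemma span_cocycle (K : comPzRingType) (R : algType K) (L M : lmodType K)
    (br : L -> L -> L) (X : 'I_3 -> 'I_3 -> R -> L) (f : L -> L -> M)
    (hb : bilin br) (hf : bilin f) x y z :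
  let gen w := (exists i j a, i != j /\ w = X i j a) \/
               (exists i j a b, i != j /\ w = br (X i j a) (X j i b)) in
  (forall x y z, gen x -> gen y -> gen z ->
     f x (br y z) = f (br x y) z - f (br x z) y) ->
  stl3_span br X x -> stl3_span br X y -> stl3_span br X z ->
  f x (br y z) = f (br x y) z - f (br x z) y.
Proof.
move=> gen hgen.
have gX i j a : i != j -> gen (X i j a) by left; exists i, j, a.
have gH i j a b : i != j -> gen (br (X i j a) (X j i b)) by right; exists i, j, a, b.
have B0 := (bilin0l hb, bilin0r hb, bilin0l hf, bilin0r hf, subrr).
have BL := (hb.1, hb.2, hf.1, hf.2).
have hz u v w : gen u -> gen v -> stl3_span br X w ->
    f u (br v w) = f (br u v) w - f (br u w) v.
  move=> gu gv; elim=> [|c w1 w2 _ h1 _ h2|i j a ij|i j a b ij];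
    try by apply: hgen; auto.
    by rewrite !B0.
  by rewrite !BL h1 h2 scalerBr opprD addrACA.
have hy u v w : gen u -> stl3_span br X v -> stl3_span br X w ->
    f u (br v w) = f (br u v) w - f (br u w) v.
  move=> gu + sw; elim=> [|c w1 w2 _ h1 _ h2|i j a ij|i j a b ij];
    try by apply: hz; auto.
    by rewrite !B0.
  by rewrite !BL h1 h2 scalerBr opprD addrACA.
move=> + sy sz; elim=> [|c w1 w2 _ h1 _ h2|i j a ij|i j a b ij];
  try by apply: hy; auto.
  by rewrite !B0.
by rewrite !BL h1 h2 scalerBr opprD addrACA.
Qed.

(** * Commutativity and 3 = 0 in [R_3] *)

Section Bar.
Variables (K : comPzRingType) (R : algType K) (R3 : lmodType K) (bar : R -> R3).
Hypothesis hbar : is_R3_quotient bar.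

Lemma bar_lin : klinear bar. Proof. by case: hbar. Qed.

Lemma bar_swap x y z : bar (x * (y * z)) = bar (x * (z * y)).
Proof.
apply/eqP; rewrite -subr_eq0 -(klinearB bar_lin) -mulrBr; apply/eqP.
case: hbar => _ _ h; apply/h; exists 0, [:: (x, y, z)].
by rewrite big_seq1 mulr0 add0r.
Qed.

Lemma barC x y : bar (x * y) = bar (y * x).
Proof. by have := bar_swap 1 x y; rewrite !mul1r. Qed.

Lemma bar_mulrn3 x : bar x *+ 3 = 0.
Proof.
rewrite -scaler_nat -(klinearZ bar_lin) scaler_nat; case: hbar => _ _ h; apply/h.
by exists x, [::]; rewrite big_nil addr0 mulr_natl.
Qed.

(** Rewrite rules that bring every order and bracketing of three factors to the normal form
    [a * b * c]. *)
Lemma barE a b c :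
  (bar (a * (b * c)) = bar (a * b * c)) * (bar (a * (c * b)) = bar (a * b * c)) *
  (bar (b * (a * c)) = bar (a * b * c)) * (bar (b * (c * a)) = bar (a * b * c)) *
  (bar (c * (a * b)) = bar (a * b * c)) * (bar (c * (b * a)) = bar (a * b * c)) *
  (bar (a * c * b) = bar (a * b * c)) *
  (bar (b * a * c) = bar (a * b * c)) * (bar (b * c * a) = bar (a * b * c)) *
  (bar (c * a * b) = bar (a * b * c)) * (bar (c * b * a) = bar (a * b * c)).
Proof.
have e1 : bar (b * a * c) = bar (a * b * c) by rewrite barC bar_swap barC.
have e2 : bar (a * c * b) = bar (a * b * c) by rewrite -!mulrA bar_swap.
have e3 : bar (b * c * a) = bar (a * b * c) by rewrite barC mulrA.
have e4 : bar (c * a * b) = bar (a * b * c) by rewrite -mulrA barC.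
have e5 : bar (c * b * a) = bar (a * b * c) by rewrite barC mulrA.
by do ![split]; rewrite ?mulrA.
Qed.

End Bar.

(** * The cocycle identity for [psi] and the span of its values *)

Section PsiCocycle.
Variables (K : comPzRingType) (R : algType K).
Variables (L : lmodType K) (br : L -> L -> L) (X : 'I_3 -> 'I_3 -> R -> L).
Hypothesis hL : is_stl3 br X.
Variables (R3 : lmodType K) (bar : R -> R3).
Hypothesis hbar : is_R3_quotient bar.
Variable psi : L -> L -> Umod R3.
Hypothesis hpsi : psi_spec br X bar psi.

Let hl : leibniz br. Proof. by case: hL. Qed.
Let hX : stl3_rels br X. Proof. by case: hL. Qed.
Let hb : bilin br := hl.1.

Lemma psi_bilin : bilin psi. Proof. by case: hpsi. Qed.
Let hp := psi_bilin.

Lemma sgnC (i j : 'I_3) : i != j -> sgn K i j = - sgn K j i.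
Proof. by rewrite -val_eqE /sgn /=; case: ltngtP => // _ _; rewrite opprK. Qed.

Lemma uvecD (u : Ucoord) (x y : R3) : uvec u (x + y) = uvec u x + uvec u y.
Proof. by apply/ffunP=> v; rewrite !ffunE; case: ifP; rewrite // addr0. Qed.

Lemma uvec0 (u : Ucoord) : uvec u 0 = 0 :> Umod R3.
Proof. by apply/ffunP=> v; rewrite !ffunE; case: ifP. Qed.

Lemma uvecZ (u : Ucoord) k (x : R3) : uvec u (k *: x) = k *: uvec u x :> Umod R3.
Proof. by apply/ffunP=> v; rewrite !ffunE; case: ifP; rewrite // scaler0. Qed.

Section Triple.
Variables (i j m : 'I_3).
Hypotheses (ij : i != j) (jm : j != m) (im : i != m).

Let ji : j != i. Proof. by rewrite eq_sym. Qed.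
Let mj : m != j. Proof. by rewrite eq_sym. Qed.
Let mi : m != i. Proof. by rewrite eq_sym. Qed.

(** Used at all six orderings of the triple, these rules evaluate every bracket of two root vectors
    except those of opposite roots, which lie in H. *)
Lemma stl3_br_table :
  (forall a b, br (X i j a) (X j m b) = X i m (a * b)) *
  (forall a b, br (X i j a) (X m i b) = - X m j (b * a)) *
  (forall a b, br (X i j a) (X i j b) = 0) *
  (forall a b, br (X i j a) (X i m b) = 0) *
  (forall a b, br (X i j a) (X m j b) = 0).
Proof.
by do ![split]=> a b; [apply: (stl3_mul hX) | apply: (stl3_mulC hX)
 | apply: (stl3_same hX) | apply: (stl3_row hX) | apply: (stl3_col hX)].
Qed.

Lemma psi_table :
  (forall a b, psi (X i j a) (X i m b) = sgn K j m *: uvec (inl i) (bar (a * b))) *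
  (forall a b, psi (X i j a) (X m j b) = sgn K i m *: uvec (inr j) (bar (a * b))) *
  (forall a b, psi (X i j a) (X i j b) = 0) *
  (forall a b, psi (X i j a) (X j i b) = 0) *
  (forall a b, psi (X i j a) (X j m b) = 0) *
  (forall a b, psi (X i j a) (X m i b) = 0) *
  (forall a b y, psi (br (X i j a) (X j i b)) y = 0) *
  (forall a b y, psi y (br (X i j a) (X j i b)) = 0).
Proof.
case: hpsi => _ h1 h2 h3 h4.
do ![split]=> a b; try by [apply: h1 | apply: h2
  | move=> y; apply: (h4 _ _ _ _ _ ij).1 | move=> y; apply: (h4 _ _ _ _ _ ij).2].
all: by apply: h3; rewrite ?eqxx ?(negbTE ij) ?(negbTE ji) ?(negbTE im) ?(negbTE jm)
  ?(negbTE mj) ?(negbTE mi).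
Qed.

End Triple.

(** Swapping the arguments reverses [sgn], and commutativity of [R_3] absorbs the reversed
    product. *)
Lemma psi_antisym i j k l a b : i != j -> k != l ->
  psi (X k l b) (X i j a) = - psi (X i j a) (X k l b).
Proof.
move=> ij; have [m [jm im]] := ord3_third ij.
have [ji mj mi] : [/\ j != i, m != j & m != i] by split; rewrite eq_sym.
have E := (psi_table ij jm im, psi_table ji im jm, psi_table im mj ij,
  psi_table mi ij mj, psi_table jm mi ji, psi_table mj ji mi).
move: k l; apply: (root_cases ij jm im); rewrite !E ?oppr0 //.
  by rewrite (sgnC mj) scaleNr (barC hbar).
by rewrite (sgnC mi) scaleNr (barC hbar).
Qed.

(** There are 36 positions of the last two roots relative to the first; the tables turn each term
    into 0 or a signed monomial in [a], [b], [c], and [barE] and [sgnC] match these. *)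
Lemma psi_cocycleX i j k l p q a b c : i != j -> k != l -> p != q ->
  psi (X i j a) (br (X k l b) (X p q c)) =
  psi (br (X i j a) (X k l b)) (X p q c) - psi (br (X i j a) (X p q c)) (X k l b).
Proof.
move=> ij; have [m [jm im]] := ord3_third ij.
have [ji mj mi] : [/\ j != i, m != j & m != i] by split; rewrite eq_sym.
have E := (psi_table ij jm im, psi_table ji im jm, psi_table im mj ij,
  psi_table mi ij mj, psi_table jm mi ji, psi_table mj ji mi).
have F := (stl3_br_table ij jm im, stl3_br_table ji im jm, stl3_br_table im mj ij,
  stl3_br_table mi ij mj, stl3_br_table jm mi ji, stl3_br_table mj ji mi).
have N := (bilinNl hp, bilinNr hp, bilin0l hp, bilin0r hp).
(* One orientation per pair of indices, so that sign normalization terminates. *)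
have S := (sgnC mj, sgnC mi, sgnC ji).
have Z := (scaleNr, @opprK (Umod R3), subr0, sub0r, subrr, addNr, addr0, add0r, oppr0).
move: k l; apply: (root_cases ij jm im); move: p q;
  apply: (root_cases ij jm im); rewrite ?F ?N ?E ?(barE hbar a b c) ?S ?Z //.
Qed.

(** The trace of [a b E_ii - b a E_jj] is a commutator, so [bar] kills all its left multiples. *)
Lemma hdiag_sum i j (a b : R) k l q : i != j -> k != l -> l != q -> k != q ->
  hdiag i j a b k + hdiag i j a b l + hdiag i j a b q = a * b - b * a.
Proof.
move=> ij; have [m [jm im]] := ord3_third ij.
have [ji mj mi] : [/\ j != i, m != j & m != i] by split; rewrite eq_sym.
pose E := (eqxx, negbTE ij, negbTE jm, negbTE im, negbTE ji, negbTE mj, negbTE mi).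
move: k l; apply: (root_cases ij jm im); have [->|->|->] := ord3_cases q ij jm im;
  rewrite /hdiag !E //= ?addr0 ?add0r // => *; by rewrite addrC ?addr0.
Qed.

(** Since 3 = 0, twice the weight at [k] is minus that weight, which equals the sum of the other two
    because the trace vanishes in [R_3]. *)
Lemma bar_hdiag i j a b k l q x : i != j -> k != l -> l != q -> k != q ->
  bar (x * hdiag i j a b k) *+ 2 = bar (x * hdiag i j a b l) + bar (x * hdiag i j a b q).
Proof.
move=> ij kl lq kq; apply/eqP; rewrite -subr_eq0.
have := congr1 (fun y => bar (x * y)) (hdiag_sum a b ij kl lq kq).
have bD := klinearD (bar_lin hbar).
rewrite mulrBr (klinearB (bar_lin hbar)) bar_swap // subrr !mulrDr !bD -addrA addrC.
by move/(canRL (addrK _)) => ->; rewrite sub0r opprK -mulrSr (bar_mulrn3 hbar).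
Qed.

(* The degree-zero part of [stl_3] acts skew-adjointly for [psi]: the weights
   [2 d_k - d_l - d_q = 3 d_k - (d_k + d_l + d_q)] vanish in [R_3]. *)
Lemma psi_act_skew i j a b k l p q c d : i != j -> k != l -> p != q ->
  psi (br (br (X i j a) (X j i b)) (X k l c)) (X p q d) =
  - psi (X k l c) (br (br (X i j a) (X j i b)) (X p q d)).
Proof.
move=> ij kl pq; rewrite !(stl3_act_l hl hX) //.
have [m [lm km]] := ord3_third kl.
have [lk ml mk] : [/\ l != k, m != l & m != k] by split; rewrite eq_sym.
have E := (psi_table kl lm km, psi_table lk km lm, psi_table km ml kl,
  psi_table mk kl ml, psi_table lm mk lk, psi_table ml lk mk).
set h := hdiag i j a b.
have bB := klinearB (bar_lin hbar).
(* For a row pair X_kl, X_km the weights are d_k - d_l and d_k - d_m, with sum 2 d_k - d_l - d_m =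
   0. A column pair X_kl, X_ml has weights of the opposite shape, handled by [keyN]. *)
have key u v w (z : Ucoord) (s : K) : u != v -> v != w -> u != w ->
   forall y1 y2, y1 = bar (c * d * h u) - bar (c * d * h v) ->
   y2 = bar (c * d * h u) - bar (c * d * h w) ->
   s *: uvec z y1 = - (s *: uvec z y2) :> Umod R3.
  move=> uv vw uw y1 y2 -> ->; rewrite -scalerN; congr (_ *: _); apply/eqP.
  rewrite -subr_eq0 opprK -uvecD addrACA -opprD -mulr2n (bar_hdiag a b _ ij uv vw uw).
  by rewrite subrr uvec0.
have keyN u v w (z : Ucoord) (s : K) : u != v -> v != w -> u != w ->
   forall y1 y2, y1 = bar (c * d * h v) - bar (c * d * h u) ->
   y2 = bar (c * d * h w) - bar (c * d * h u) ->
   s *: uvec z y1 = - (s *: uvec z y2) :> Umod R3.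
  move=> uv vw uw y1 y2 -> ->; rewrite -[y in _ *: uvec z y = _]opprB.
  rewrite -[y in _ = - (_ *: uvec z y)]opprB -!scaleN1r !uvecZ !scaleN1r !scalerN.
  by congr (- _); apply: (key u v w).
move: p q pq; apply: (root_cases kl lm km); rewrite ?E ?oppr0 //.
  apply: (key k l m) => //; rewrite ?mulrBl ?mulrBr bB.
    by rewrite (barE hbar c d (h k)) (barE hbar c d (h l)).
  by rewrite (barE hbar c d (h k)) (barE hbar c d (h m)).
apply: (keyN l k m) => //; rewrite ?mulrBl ?mulrBr bB.
  by rewrite (barE hbar c d (h k)) (barE hbar c d (h l)).
by rewrite (barE hbar c d (h m)) (barE hbar c d (h l)).
Qed.

(** With one argument in H the identity is skew-adjointness, combined with antisymmetry of [psi]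
    when that argument comes first. With two or more in H every term vanishes. *)
Lemma psi_cocycle : cocycle br psi.
Proof.
split=> [|x y z]; first exact: hp.
apply: (span_cocycle hb hp _ (stl3_spanned hL x) (stl3_spanned hL y) (stl3_spanned hL z)).
have H1 i j a b u : i != j -> psi (br (X i j a) (X j i b)) u = 0.
  by case: hpsi => _ _ _ _ h ij; apply: (h _ _ _ _ _ ij).1.
have H2 i j a b u : i != j -> psi u (br (X i j a) (X j i b)) = 0.
  by case: hpsi => _ _ _ _ h ij; apply: (h _ _ _ _ _ ij).2.
(* Brackets of elements of H fall back into H, where [psi] vanishes. *)
have HH i j a b k l a' b' u : i != j -> k != l ->
    let hh := br (br (X i j a) (X j i b)) (br (X k l a') (X l k b')) in
    psi hh u = 0 /\ psi u hh = 0.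
  move=> ij kl hh; have lk : l != k by rewrite eq_sym.
  rewrite /hh hl.2 !(stl3_act_l hl hX) // (klinearB (bilin_l hp u)) (klinearB (bilin_r hp u)).
  by rewrite !(H1 _ _ _ _ _ kl) !(H1 _ _ _ _ _ lk) !(H2 _ _ _ _ _ kl) !(H2 _ _ _ _ _ lk) subrr.
have [N1 N2] := (bilinNl hp, bilinNr hp).
move=> {}x {}y {}z [[i [j [a [ij ->]]]]|[i [j [a [b [ij ->]]]]]]
  [[k [l [c [kl ->]]]]|[k [l [c [d [kl ->]]]]]]
  [[p [q [e [pq ->]]]]|[p [q [e [g [pq ->]]]]]].
- exact: psi_cocycleX.
- rewrite (stl3_act_r hl hX) // (stl3_act_r hl hX) // N1 N2 (H2 _ _ _ _ _ pq).
  by rewrite (psi_act_skew _ _ _ _ pq ij kl) sub0r opprK.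
- rewrite (stl3_act_r hl hX) // N1 (H2 _ _ _ _ _ kl) subr0.
  by rewrite (psi_act_skew _ _ _ _ kl ij pq) opprK.
- rewrite (HH _ _ _ _ _ _ _ _ _ kl pq).2 (stl3_act_r hl hX) // (stl3_act_r hl hX) //.
  by rewrite !N1 (H2 _ _ _ _ _ pq) (H2 _ _ _ _ _ kl) subrr.
- rewrite (H1 _ _ _ _ _ ij) (psi_act_skew _ _ _ _ ij kl pq).
  rewrite [psi (br _ (X p q e)) _](_ : _ = - psi (X k l c) (br (br (X i j a) (X j i b)) (X
    p q e))) ?subrr //.
  by rewrite (stl3_act_l hl hX) // psi_antisym.
- rewrite (H1 _ _ _ _ _ ij) (H2 _ _ _ _ _ pq).
  by rewrite (HH _ _ _ _ _ _ _ _ _ ij pq).1 subrr.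
- rewrite (H1 _ _ _ _ _ ij) (HH _ _ _ _ _ _ _ _ _ ij kl).1.
  by rewrite (H2 _ _ _ _ _ kl) subrr.
- rewrite (H1 _ _ _ _ _ ij) (HH _ _ _ _ _ _ _ _ _ ij kl).1.
  by rewrite (HH _ _ _ _ _ _ _ _ _ ij pq).1 subrr.
Qed.

Lemma ord3_triple (i : 'I_3) : exists j m, [/\ i != j, j != m & i != m].
Proof.
have [j ij] : exists j : 'I_3, i != j.
  exists (if i == ord0 then ord_max else ord0).
  by case: (eqVneq i ord0) => [->|].
by have [m [jm im]] := ord3_third ij; exists j, m.
Qed.

Lemma sgn_sqr (i j : 'I_3) : sgn K i j * sgn K i j = 1.
Proof. by rewrite /sgn; case: ifP => _; rewrite ?mulrNN mulr1. Qed.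

(** Each [uvec] is, up to sign, a value of [psi] on two commuting root vectors of one row or column,
    one of them with coefficient 1. Such pairs are 2-cycles, and in the extension their brackets are
    the elements of U. *)
Lemma psi_ind (P : Umod R3 -> Prop) : P 0 ->
  (forall (k : K) u v, P u -> P v -> P (k *: u + v)) ->
  (forall x y, br x y = 0 -> P (psi x y)) -> forall u, P u.
Proof.
move=> P0 Plin Ppsi.
have PZ k u : P u -> P (k *: u) by move=> Pu; rewrite -[_ *: _]addr0; apply: Plin.
have Pv (z : Ucoord) (v : R3) : P (uvec z v).
  have [a <-] : exists a, bar a = v by case: hbar.
  case: z => i; have [j [m [ij jm im]]] := ord3_triple i; rewrite -[a]mulr1.
    rewrite -[uvec _ _]scale1r -(sgn_sqr j m) -scalerA -(psi_table ij jm im).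
    by apply/PZ/Ppsi/(stl3_row hX).
  have [ji mi] : j != i /\ m != i by split; rewrite eq_sym.
  rewrite -[uvec _ _]scale1r -(sgn_sqr j m) -scalerA -(psi_table ji im jm).
  by apply/PZ/Ppsi/(stl3_col hX).
move=> u; have -> : u = \sum_z uvec z (u z).
  apply/ffunP=> z; rewrite sum_ffunE (bigD1 z) //= big1 => [|t tz]; rewrite ffunE ?eqxx
    ?addr0 //.
  by rewrite eq_sym (negbTE tz).
by elim/big_ind: _ => // x y Px Py; rewrite -[x]scale1r; apply: Plin.
Qed.

Lemma psi_span (M : lmodType K) (d : Umod R3 -> M) : klinear d ->
  (forall x y, br x y = 0 -> d (psi x y) = 0) -> forall u, d u = 0.
Proof.
move=> hd; apply: psi_ind => [|k u v du dv]; first exact: klinear0.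
by rewrite hd du dv scaler0 addr0.
Qed.

End PsiCocycle.

(** * Arbitrary cocycles *)

(** The map evaluates [w] at a chosen preimage under [bar]; [wK] makes the choice immaterial. *)
Lemma bar_factor (K : comPzRingType) (R : algType K) (R3 : lmodType K) (bar : R -> R3)
    (M : lmodType K) (w : R -> M) :
  is_R3_quotient bar -> klinear w -> (forall x, w x *+ 3 = 0) ->
  (forall x y z, w (x * (y * z)) = w (x * (z * y))) ->
  exists al : R3 -> M, klinear al /\ forall a, al (bar a) = w a.
Proof.
move=> [hbar bar_surj bar_ker] hw w3 wC.
have ex y : exists x, bar x == y by have [x <-] := bar_surj y; exists x.
have wK x : bar x = 0 -> w x = 0.
  case/bar_ker=> r [s ->]; rewrite (klinearD hw) mulr_natl.
  rewrite -scaler_nat (klinearZ hw) scaler_nat w3 add0r.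
  elim/big_ind: _ => [|u v wu wv|q _]; first exact: klinear0.
    by rewrite (klinearD hw) wu wv addr0.
  by rewrite mulrBr (klinearB hw) wC subrr.
have alE a : w (xchoose (ex (bar a))) = w a.
  apply/eqP; rewrite -subr_eq0 -(klinearB hw); apply/eqP/wK.
  by rewrite (klinearB hbar) (eqP (xchooseP (ex _))) subrr.
exists (fun y => w (xchoose (ex y))); split=> // k x y.
have [a <-] := bar_surj x; have [b <-] := bar_surj y.
by rewrite -hbar !alE hw.
Qed.

Section Cocycle.
Variables (K : comPzRingType) (R : algType K).
Variables (L : lmodType K) (br : L -> L -> L) (X : 'I_3 -> 'I_3 -> R -> L).
Hypothesis hL : is_stl3 br X.
Variables (M : lmodType K) (f : L -> L -> M).
Hypothesis hf : cocycle br f.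

Let hl : leibniz br. Proof. by case: hL. Qed.
Let hX : stl3_rels br X. Proof. by case: hL. Qed.
Let hb : bilin br := hl.1.
Let fb : bilin f := hf.1.
Let fr x y z : f x (br y z) = f (br x y) z - f (br x z) y := hf.2 x y z.

Let fl x y z : f (br x y) z = f x (br y z) + f (br x z) y.
Proof. by rewrite fr subrK. Qed.

(* A cocycle vanishes on [(X_kl(c), w)] and [(w, X_kl(c))] when [w] commutes
   with all [X_pq], because [X_kl(c)] is itself a bracket of such elements. *)
Lemma cocycle_central w :
  (forall k l c, k != l -> br w (X k l c) = 0 /\ br (X k l c) w = 0) ->
  forall k l c, k != l -> f w (X k l c) = 0 /\ f (X k l c) w = 0.
Proof.
move=> hw k l c kl; have [m [lm km]] := ord3_third kl.
have ml : m != l by rewrite eq_sym.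
rewrite -[c]mulr1 -(stl3_mul hX km ml kl) fr (fl (X k m c) (X m l 1) w).
have [-> ->] := hw k m c km; have [-> ->] := hw m l 1 ml.
by rewrite !(bilin0l fb) !(bilin0r fb) subrr addr0.
Qed.

Section Triple.
Variables (i j m : 'I_3).
Hypotheses (ij : i != j) (jm : j != m) (im : i != m).

Let ji : j != i. Proof. by rewrite eq_sym. Qed.
Let mj : m != j. Proof. by rewrite eq_sym. Qed.
Let mi : m != i. Proof. by rewrite eq_sym. Qed.

Let B := (stl3_br_table hL ij jm im, stl3_br_table hL ji im jm, stl3_br_table hL im mj ij,
  stl3_br_table hL mi ij mj, stl3_br_table hL jm mi ji, stl3_br_table hL mj ji mi).

Lemma cocycle_mul_diag a b c :
  f (X i j (a * b)) (X j m c) = f (X i m a) (br (X m j b) (X j m c)).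
Proof. by rewrite -(stl3_mul hX im mj ij) fl B (bilin0l fb) addr0. Qed.

(** Both sides pair X_im(a) with an element of H, namely [X_mj(1), X_jm(b)] and [X_mj(b), X_jm(1)].
    Their diagonal entries agree, so the difference falls under [cocycle_central]. *)
Lemma cocycle_mul a b : f (X i j a) (X j m b) = f (X i j (a * b)) (X j m 1).
Proof.
rewrite -[a in LHS]mulr1 !cocycle_mul_diag; apply/eqP.
rewrite -subr_eq0 -(klinearB (bilin_r fb _)); apply/eqP.
apply: (cocycle_central _ _ im).2 => k l c kl.
rewrite (klinearB (bilin_l hb _)) (klinearB (bilin_r hb _)).
by rewrite !(stl3_act_r hl hX) // !(stl3_act_l hl hX) // /hdiag !mulr1 !mul1r !subrr.
Qed.

Lemma cocycle_mulC_diag a b : f (X i j a) (X m i b) = f (br (X i m a) (X m i b)) (X m j 1).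
Proof. by rewrite -[a in LHS]mulr1 -(stl3_mul hX im mj ij) fl B (bilin0r fb) add0r. Qed.

Lemma cocycle_mulC_diag' a b : f (X m i b) (X i j a) = f (br (X m i b) (X i m a)) (X m j 1).
Proof. by rewrite -[a in LHS]mulr1 -(stl3_mul hX im mj ij) fr !B (bilin0l fb) subr0. Qed.

(** The diagonals of [X_im(a), X_mi(b)] and [X_mi(b), X_im(a)] cancel, so [cocycle_central] applies
    to their sum. *)
Lemma cocycle_mulC a b : f (X i j a) (X m i b) = - f (X m i b) (X i j a).
Proof.
rewrite cocycle_mulC_diag cocycle_mulC_diag'; apply/eqP.
rewrite -subr_eq0 opprK -(bilinDl fb); apply/eqP.
apply: (cocycle_central _ _ mj).1 => k l c kl.
rewrite (bilinDl hb) (bilinDr hb) !(stl3_act_r hl hX) // !(stl3_act_l hl hX) //.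
rewrite -opprD -(klinearD (stl3_lin hX kl)) addrACA -opprD -mulrDl -mulrDr.
have D u : hdiag i m a b u + hdiag m i b a u = 0.
  rewrite /hdiag; case: (eqVneq u i) => [->|_]; first by rewrite (negbTE im) subrr.
  by case: ifP => _; rewrite ?addNr ?addr0.
by rewrite !D mul0r mulr0 subrr (klinear0 (stl3_lin hX kl)) oppr0.
Qed.

Lemma cocycle_same a b : f (X i j a) (X i j b) = 0.
Proof. by rewrite -[b]mulr1 -(stl3_mul hX im mj ij) fr !B !(bilin0l fb) subrr. Qed.

(** Expanding X_im(bc) moves [c] to the other argument: [c = 1] yields antisymmetry, and [b = 1]
    yields dependence on the product alone. *)
Lemma cocycle_row a b c : f (X i j a) (X i m (b * c)) = - f (X i m (a * c)) (X i j b).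
Proof. by rewrite -(stl3_mul hX ij jm im) fr !B (bilin0l fb) sub0r. Qed.

Lemma cocycle_col a b c : f (X i j a) (X m j (c * b)) = - f (X m j (c * a)) (X i j b).
Proof. by rewrite -(stl3_mul hX mi ij mj) fr !B (bilinNl fb) (bilin0l fb) subr0. Qed.

(* [[X_ij(1), X_ji(1)]] acts on the two arguments with weights 2 and 1, so
   invariance of [f] multiplies the value by 3. *)
Lemma cocycle_row3 a b : f (X i j a) (X i m b) *+ 3 = 0.
Proof.
have := fr (X i j a) (br (X i j 1) (X j i 1)) (X i m b).
rewrite (stl3_act_r hl hX) // !(stl3_act_l hl hX) // /hdiag !eqxx.
rewrite (negbTE ji) ![m == _]eq_sym (negbTE im) (negbTE jm) B (bilin0l fb) subr0.
rewrite !mulr1 mulr0 subr0 !mul1r mulrN mulr1 opprK -mulr2n (bilinNl fb).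
rewrite (klinearD (stl3_lin hX ij)) (bilinDl fb) => /eqP.
by rewrite -subr_eq0 opprK -mulr2n -mulrS => /eqP.
Qed.

Lemma cocycle_col3 a b : f (X i j a) (X m j b) *+ 3 = 0.
Proof.
have := fr (X i j a) (br (X i j 1) (X j i 1)) (X m j b).
rewrite (stl3_act_r hl hX) // !(stl3_act_l hl hX) // /hdiag !eqxx.
rewrite (negbTE ji) ![m == _]eq_sym (negbTE im) (negbTE jm) B (bilin0l fb) subr0.
rewrite !mulr1 mul0r sub0r !mul1r !mulrN !mulr1 !opprK -mulr2n (bilinNl fb).
rewrite (klinearD (stl3_lin hX ij)) (bilinDl fb) => /eqP.
by rewrite -subr_eq0 opprK -mulr2n -mulrS => /eqP.
Qed.

Lemma cocycle_row_mul a b : f (X i j a) (X i m b) = f (X i j (a * b)) (X i m 1).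
Proof.
rewrite -[b in LHS]mul1r cocycle_row -[a * b in LHS]mulr1 -[1 in RHS]mulr1 cocycle_row.
by rewrite mulr1.
Qed.

Lemma cocycle_col_mul a b : f (X i j a) (X m j b) = f (X i j (b * a)) (X m j 1).
Proof.
rewrite -[b in LHS]mulr1 cocycle_col -[b * a in LHS]mul1r -[1 in RHS]mulr1 cocycle_col.
by rewrite mul1r.
Qed.

Lemma cocycle_row_swap a b : f (X i m a) (X i j b) = - f (X i j a) (X i m b).
Proof. by rewrite -[b in RHS]mulr1 cocycle_row mulr1 opprK. Qed.

Lemma cocycle_col_swap a b : f (X m j a) (X i j b) = - f (X i j a) (X m j b).
Proof. by rewrite -[b in RHS]mul1r cocycle_col mul1r opprK. Qed.

End Triple.

(** * Row and column values as linear maps on [R_3] *)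

Variables (R3 : lmodType K) (bar : R -> R3).
Hypothesis hbar : is_R3_quotient bar.

Lemma cocycle_row_factor i : exists al : R3 -> M, klinear al /\
  forall j m a b, i != j -> j != m -> i != m ->
    f (X i j a) (X i m b) = sgn K j m *: al (bar (a * b)).
Proof.
have [j [m [ij jm im]]] := ord3_triple i.
have mj : m != j by rewrite eq_sym.
(* The sign makes [w] serve both orders of the pair [j], [m]. *)
pose w a := sgn K j m *: f (X i j a) (X i m 1).
have W a b : f (X i j a) (X i m b) = sgn K j m *: w (a * b).
  by rewrite scalerA sgn_sqr scale1r -cocycle_row_mul.
have wlin : klinear w.
  by move=> k x y; rewrite /w (stl3_lin hX ij) fb.1 scalerDr !scalerA mulrC.
have w3 x : w x *+ 3 = 0 by rewrite /w scalerMnr cocycle_row3 // scaler0.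
have wC x y z : w (x * (y * z)) = w (x * (z * y)).
  rewrite /w; congr (_ *: _); rewrite -cocycle_row_mul // cocycle_row //.
  by rewrite -cocycle_row_swap // cocycle_row_mul // mulrA.
have [al [hal alE]] := bar_factor hbar wlin w3 wC.
exists al; split=> // j' m' a b.
have [->|->|->] := ord3_cases j' ij jm im; rewrite ?eqxx //;
  have [->|->|->] := ord3_cases m' ij jm im; rewrite ?eqxx // => *; rewrite alE //.
by rewrite cocycle_row_swap // W (sgnC K mj) scaleNr.
Qed.

Lemma cocycle_col_factor j : exists al : R3 -> M, klinear al /\
  forall i m a b, i != j -> j != m -> i != m ->
    f (X i j a) (X m j b) = sgn K i m *: al (bar (a * b)).
Proof.
have [i [m [ji im jm]]] := ord3_triple j.
have [ij mi mj] : [/\ i != j, m != i & m != j] by split; rewrite eq_sym.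
pose w a := sgn K i m *: f (X i j a) (X m j 1).
(* The column identity exchanges the two left factors; [a = 1] then gives commutativity, which moves
   the exchange to the right as [bar_factor] requires. *)
have swap a b c : f (X i j (b * c * a)) (X m j 1) = f (X i j (c * b * a)) (X m j 1).
  have := cocycle_col ij jm im a b c; rewrite (cocycle_col_swap ij jm im) opprK.
  by rewrite (cocycle_col_mul ij jm im a) (cocycle_col_mul ij jm im (c * a)) mulrA.
have wlin : klinear w.
  by move=> k x y; rewrite /w (stl3_lin hX ij) fb.1 scalerDr !scalerA mulrC.
have w3 x : w x *+ 3 = 0 by rewrite /w scalerMnr cocycle_col3 // scaler0.
have wC2 x y : w (x * y) = w (y * x).
  by rewrite /w -[x * y]mulr1 swap mulr1.
have W a b : f (X i j a) (X m j b) = sgn K i m *: w (a * b).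
  by rewrite wC2 scalerA sgn_sqr scale1r -cocycle_col_mul.
have wC x y z : w (x * (y * z)) = w (x * (z * y)).
  by rewrite wC2 [RHS]wC2 /w swap.
have [al [hal alE]] := bar_factor hbar wlin w3 wC.
exists al; split=> // i' m' a b.
have [->|->|->] := ord3_cases i' ij jm im; rewrite ?eqxx //;
  have [->|->|->] := ord3_cases m' ij jm im; rewrite ?eqxx // => *; rewrite alE //.
by rewrite cocycle_col_swap // W (sgnC K mi) scaleNr.
Qed.

End Cocycle.

(** * The universal central extension *)

Section Trivialization.
Variables (K : comPzRingType) (R : algType K).
Variables (L : lmodType K) (br : L -> L -> L) (X : 'I_3 -> 'I_3 -> R -> L).
Hypothesis hL : is_stl3 br X.
Variables (R3 : lmodType K) (bar : R -> R3).
Hypothesis hbar : is_R3_quotient bar.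
Variable psi : L -> L -> Umod R3.
Hypothesis hpsi : psi_spec br X bar psi.

Let hl : leibniz br. Proof. by case: hL. Qed.
Let hX : stl3_rels br X. Proof. by case: hL. Qed.

Lemma cocycle_coboundary (M : lmodType K) (f : L -> L -> M) : cocycle br f ->
  (forall i j m a b, i != j -> j != m -> i != m -> f (X i j a) (X i m b) = 0) ->
  (forall i j m a b, i != j -> j != m -> i != m -> f (X i j a) (X m j b) = 0) ->
  exists g : L -> M, klinear g /\ forall x y, f x y = g (br x y).
Proof.
move=> hf frow fcol.
have fb := hf.1.
pose brE : M * L -> M * L -> M * L := ext_bracket br f.
have hE : leibniz brE by exact: ext_leibniz.
(* The implication makes the third index a total function; its value on equal indices is
   irrelevant. *)
have ex3 (q : 'I_3 * 'I_3) : exists m, (q.1 != q.2) ==> (q.2 != m) && (q.1 != m).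
  case: (boolP (q.1 != q.2)) => [/ord3_third[m [h1 h2]]|_]; last by exists ord0.
  by exists m; rewrite h1 h2.
pose thd i j := xchoose (ex3 (i, j)).
have thdE i j m : i != j -> j != m -> i != m -> thd i j = m.
  move=> ij jm im; have /implyP := xchooseP (ex3 (i, j)); rewrite -/(thd i j) /=.
  move=> /(_ ij) /andP[].
  by have [->|->|->] := ord3_cases (thd i j) ij jm im; rewrite ?eqxx.
pose Y i j a : M * L := (f (X i (thd i j) a) (X (thd i j) j 1), X i j a).
have YE i j m a : i != j -> j != m -> i != m ->
    Y i j a = (f (X i m a) (X m j 1), X i j a).
  by move=> ij jm im; rewrite /Y (thdE i j m).
have hY : stl3_rels brE Y.
  split.
  - move=> i j ij k a b; have [m [jm im]] := ord3_third ij.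
    by rewrite !(YE i j m) // (stl3_lin hX im) (stl3_lin hX ij) fb.1.
  - move=> i j k a b ij jk ik; have kj : k != j by rewrite eq_sym.
    rewrite (YE i k j) // /brE /ext_bracket /= (cocycle_mul hL hf) //.
    by rewrite (stl3_mul hX).
  - move=> i j k a b ij jk ik.
    have [ki kj ji] : [/\ k != i, k != j & j != i] by split; rewrite eq_sym.
    rewrite (YE k j i) // /brE /ext_bracket /= (cocycle_mulC hL hf) //.
    by rewrite (cocycle_mul hL hf) // (stl3_mulC hX).
  (* Rows and columns commute in [L]; their lifts do so because [f] vanishes there. *)
  - move=> i j k l a b ij kl; have [m [jm im]] := ord3_third ij.
    have [ji mj mi] : [/\ j != i, m != j & m != i] by split; rewrite eq_sym.
    rewrite /brE /ext_bracket /=.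
    move: k l kl; apply: (root_cases ij jm im); rewrite ?eqxx // => _ _.
    + by rewrite (cocycle_same hL hf ij jm im) (stl3_same hX).
    + by rewrite frow // (stl3_row hX).
    + by rewrite fcol // (stl3_col hX).
case: (hL) => _ _ hU.
have [phi [[plin pbr] pX _]] := hU _ brE Y hE hY.
have [id' [_ _ idU]] := hU L br X hl hX.
(* The second component of [phi] is an endomorphism fixing the generators, so [phi] is a section and
   its first component is the required [g]. *)
have phi2 x : (phi x).2 = x.
  transitivity (id' x); last by apply/esym/(idU id).
  apply: (idU (fun x => (phi x).2)); first by split=> [k u v|u v]; rewrite ?plin ?pbr.
  by move=> i j a ij; rewrite pX.
exists (fun x => (phi x).1); split=> [k x y|x y]; first by rewrite plin.
by rewrite pbr /brE /ext_bracket /= !phi2.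
Qed.

Lemma cocycle_decomp (M : lmodType K) (f : L -> L -> M) : cocycle br f ->
  exists (al : Umod R3 -> M) (g : L -> M),
    [/\ klinear al, klinear g & forall x y, f x y = al (psi x y) + g (br x y)].
Proof.
move=> hf; have [hp hpc] := psi_cocycle hL hbar hpsi.
have [alr /all_and2 [alr_lin alrE]] := fin_all_exists (cocycle_row_factor hL hf hbar).
have [alc /all_and2 [alc_lin alcE]] := fin_all_exists (cocycle_col_factor hL hf hbar).
pose alz (z : Ucoord) := match z with inl i => alr i | inr j => alc j end.
have alz_lin z : klinear (alz z) by case: z.
(* Row maps act on the positive coordinates and column maps on the negative ones. *)
pose al (u : Umod R3) := \sum_z alz z (u z).
have al_lin : klinear al.
  move=> k u v; rewrite /al scaler_sumr -big_split; apply: eq_bigr => z _ /=.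
  by rewrite !ffunE alz_lin.
have al_uvec s z v : al (s *: uvec z v) = s *: alz z v.
  rewrite (klinearZ al_lin); congr (_ *: _).
  rewrite /al (bigD1 z) //= big1 => [|t tz]; rewrite ffunE ?eqxx ?addr0 //.
  by rewrite (negbTE tz) (klinear0 (alz_lin t)).
pose f' x y := f x y - al (psi x y).
have hf' : cocycle br f'.
  split; first split=> k x y z.
  - by rewrite /f' hf.1.1 hp.1 al_lin scalerBr opprD addrACA.
  - by rewrite /f' hf.1.2 hp.2 al_lin scalerBr opprD addrACA.
  - by move=> x y z; rewrite /f' hf.2 hpc (klinearB al_lin) !opprB addrACA [RHS]addrACA;
    congr (_ + _); apply: addrC.
have [||g [g_lin gE]] := cocycle_coboundary hf'.
- by move=> i j m a b ij jm im; rewrite /f' (psi_table hpsi ij jm im) al_uvec alrE // subrr.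
- by move=> i j m a b ij jm im; rewrite /f' (psi_table hpsi ij jm im) al_uvec alcE // subrr.
by exists al, g; split=> // x y; rewrite -gE addrC subrK.
Qed.

Lemma stl3_universal_central_ext :
  universal_central_ext br (ext_bracket br psi) (@snd (Umod R3) L).
Proof.
have hpsic := psi_cocycle hL hbar hpsi; have [hp _] := hpsic.
split.
  split.
  - exact: ext_leibniz.
  - by split.
  - by move=> x; exists (0, x).
  - move=> [u z] /= -> [v x]; rewrite /ext_bracket /=.
    by rewrite (bilin0l hp) (bilin0r hp) (bilin0l hl.1) (bilin0r hl.1).
  - by exists (fun x => (0, x)); split=> // k x y; apply: injective_projections;
    rewrite //= scaler0 addr0.
move=> M brM t [[bM jM] [tlin tbr] _ tcen [s [slin ts]]].
have cen0 c x : t c = 0 -> brM c x = 0 /\ brM x c = 0 by move=> /tcen.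
(* The defect of the linear section [s]; its values lie in the central kernel of [t]. *)
pose f x y := brM (s x) (s y) - s (br x y).
have tf x y : t (f x y) = 0 by rewrite (klinearB tlin) tbr !ts subrr.
have sbr x y : brM (s x) (s y) = f x y + s (br x y) by rewrite subrK.
have fcen u v w z : brM (f u v + w) z = brM w z.
  by rewrite (bilinDl bM (f u v)) (cen0 _ _ (tf _ _)).1 add0r.
have hf : cocycle br f.
  split; first split=> k x y z.
  - by rewrite /f slin bM.1 hl.1.1 slin scalerBr opprD addrACA.
  - by rewrite /f slin bM.2 hl.1.2 slin scalerBr opprD addrACA.
  move=> x y z.
  have : brM (s x) (brM (s y) (s z)) = f x (br y z) + s (br x (br y z)).
    by rewrite sbr (bilinDr bM _ (f y z)) (cen0 _ _ (tf _ _)).2 add0r sbr.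
  rewrite jM !sbr !fcen !sbr hl.2 (klinearB slin).
  by rewrite opprD addrACA => /addIr.
have [al [g [al_lin g_lin fE]]] := cocycle_decomp hf.
(* On commuting pairs [al] of [psi] is a value of [f], and these pairs span U; perfectness of [L]
   then handles [g]. *)
have tal u : t (al u) = 0.
  apply: (psi_span hL hbar hpsi (d := t \o al)).
    by move=> k x y /=; rewrite al_lin tlin.
  by move=> x y xy /=; have := tf x y; rewrite fE xy (klinear0 g_lin) addr0.
have tg x : t (g x) = 0.
  apply: (stl3_perfect hL (d := t \o g)).
    by move=> k u v /=; rewrite g_lin tlin.
  by move=> u v /=; have := tf u v; rewrite fE (klinearD tlin) tal add0r.
(* Correcting [s] by the central terms [al] and [g] absorbs the defect [f]. *)
pose eta (z : Umod R3 * L) := al z.1 + g z.2 + s z.2.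
have eta_lin : klinear eta.
  move=> k [u x] [v y]; rewrite /eta /= al_lin g_lin slin !scalerDr.
  by rewrite [RHS]addrACA; congr (_ + _); apply: addrACA.
have eta_br z z' : eta (ext_bracket br psi z z') = brM (eta z) (eta z').
  case: z z' => [u x] [v y]; rewrite /eta /ext_bracket /=.
  have tc u' x' : t (al u' + g x') = 0 by rewrite (klinearD tlin) tal tg addr0.
  rewrite (bilinDl bM) (cen0 _ _ (tc _ _)).1 add0r.
  by rewrite (bilinDr bM) (cen0 _ _ (tc _ _)).2 add0r -fE sbr.
have eta_t z : t (eta z) = z.2.
  by rewrite /eta !(klinearD tlin) tal tg ts !add0r.
exists eta; split=> // eta' [elin ebr] et.
(* The difference of two lifts is central-valued, so it kills brackets; it vanishes since the
   extension is perfect. *)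
pose d z := eta' z - eta z.
have d_lin : klinear d.
  by move=> k z z'; rewrite /d elin eta_lin scalerBr opprD addrACA.
have td z : t (d z) = 0 by rewrite (klinearB tlin) et eta_t subrr.
have d_br z z' : d (ext_bracket br psi z z') = 0.
  have E z1 : eta' z1 = d z1 + eta z1 by rewrite subrK.
  rewrite {1}/d ebr eta_br !E (bilinDl bM) (cen0 _ _ (td _)).1 add0r.
  by rewrite (bilinDr bM) (cen0 _ _ (td _)).2 add0r subrr.
have d0 u : d (u, 0) = 0.
  apply: (psi_span hL hbar hpsi (d := fun u => d (u, 0))).
    by move=> k u' v; rewrite -d_lin; congr d; apply: injective_projections; rewrite //=
      scaler0 addr0.
  by move=> x y xy; rewrite -xy; apply: (d_br (0, x) (0, y)).
have dL x : d (0, x) = 0.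
  apply: (stl3_perfect hL (d := fun x => d (0, x))).
    by move=> k u v; rewrite -d_lin; congr d; apply: injective_projections; rewrite //=
      scaler0 addr0.
  move=> x' y; have -> : (0, br x' y) = ext_bracket br psi (0, x') (0, y) - (psi x' y, 0).
    by apply: injective_projections; rewrite /= ?subrr ?subr0.
  by rewrite (klinearB d_lin) d_br d0 subrr.
move=> [u x]; apply/eqP; rewrite -subr_eq0 -/(d _) -[d _](_ : d ((u, 0) + (0, x)) = _).
  by rewrite (klinearD d_lin) d0 dL addr0.
by congr d; apply: injective_projections; rewrite /= ?addr0 ?add0r.
Qed.

End Trivialization.

(** * Tensors modulo boundaries *)

Section TensorQuotient.
Variables (K : comPzRingType) (L : lmodType K) (br : L -> L -> L).
Hypothesis hb : bilin br.

Let T := seq (L * L).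
Definition tscale (a : K) (s : T) : T := [seq (a *: q.1, q.2) | q <- s].

Lemma ev_scale (M : lmodType K) (f : L -> L -> M) a s : bilin f ->
  \sum_(q <- tscale a s) f q.1 q.2 = a *: \sum_(q <- s) f q.1 q.2.
Proof. by move=> hf; rewrite big_map scaler_sumr; apply: eq_bigr => q _; rewrite (bilinZl
  hf). Qed.

Lemma delta3_cat w w' : delta3 br (w ++ w') = delta3 br w ++ delta3 br w'.
Proof. by rewrite /delta3 map_cat flatten_cat. Qed.

(** Bilinear maps send boundaries to sums of cocycle defects, so cocycles are exactly those that
    kill boundaries. *)
Lemma ev_delta3 (M : lmodType K) (f : L -> L -> M) w : bilin f ->
  \sum_(q <- delta3 br w) f q.1 q.2 =
  \sum_(q <- w) (f q.1.1 (br q.1.2 q.2) - (f (br q.1.1 q.1.2) q.2 - f (br q.1.1 q.2) q.1.2)).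
Proof.
move=> hf; rewrite big_flatten big_map; apply: eq_bigr => q _.
by rewrite !big_cons big_nil /= addr0 (bilinNl hf) opprB [LHS]addrC -addrA addrCA.
Qed.

Lemma ev_delta3_cocycle (M : lmodType K) (f : L -> L -> M) w : cocycle br f ->
  \sum_(q <- delta3 br w) f q.1 q.2 = 0.
Proof.
by move=> [hf fc]; rewrite ev_delta3 // big1 // => q _; rewrite fc subrr.
Qed.

Definition homologous (s s' : T) := exists w, tensor_eq s (s' ++ delta3 br w).

Lemma tensor_eq_homologous s s' : tensor_eq s s' -> homologous s s'.
Proof. by move=> h; exists [::]; rewrite /delta3 /= cats0. Qed.

Lemma homologous_scale a s s' : homologous s s' -> homologous (tscale a s) (tscale a s').
Proof.
move=> [w hw]; exists [seq ((a *: q.1.1, q.1.2), q.2) | q <- w] => M f hf.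
rewrite big_cat /= !ev_scale // hw // big_cat scalerDr; congr (_ + _).
rewrite !ev_delta3 // big_map scaler_sumr; apply: eq_bigr => q _ /=.
by rewrite !(bilinZl hf, bilinZl hb) !scalerBr.
Qed.

Lemma homologous_cat s1 s1' s2 s2' : homologous s1 s1' -> homologous s2 s2' ->
  homologous (s1 ++ s2) (s1' ++ s2').
Proof.
move=> [w1 h1] [w2 h2]; exists (w1 ++ w2) => M f hf.
by rewrite delta3_cat !big_cat /= h1 // h2 // !big_cat /= addrACA.
Qed.

Lemma homologous_refl s : homologous s s.
Proof. exact: tensor_eq_homologous. Qed.

Lemma homologous_sym s s' : homologous s s' -> homologous s' s.
Proof.
move=> [w hw]; exists [seq ((- q.1.1, q.1.2), q.2) | q <- w] => M f hf.
(* Negating the first entries of [w] negates its boundary. *)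
rewrite big_cat /= hw // big_cat /= -addrA !ev_delta3 // big_map -big_split /=.
rewrite -[LHS]addr0; congr (_ + _); rewrite big1 // => q _.
by rewrite !(bilinNl hf, bilinNl hb) -!opprD subrr.
Qed.

Lemma homologous_trans s1 s2 s3 : homologous s1 s2 -> homologous s2 s3 -> homologous s1 s3.
Proof.
move=> [w1 h1] [w2 h2]; exists (w2 ++ w1) => M f hf.
by rewrite h1 // delta3_cat catA big_cat /= h2 // -big_cat.
Qed.

Definition homologousb : rel T := fun s s' => `[< homologous s s' >].

Lemma homologousb_equiv : equiv_class_of homologousb.
Proof.
split=> [s|s s'|s2 s1 s3].
- exact/asboolP/homologous_refl.
- by apply/asboolP/asboolP; apply: homologous_sym.
- by move=> /asboolP h /asboolP h'; apply/asboolP/(homologous_trans h h').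
Qed.

Definition homologous_rel := EquivRelPack homologousb_equiv.

(* [L (x) L] modulo the image of [delta3]. *)
Definition tquot := {eq_quot homologous_rel}.
HB.instance Definition _ := Choice.on tquot.
HB.instance Definition _ := EqQuotient.on tquot.

Definition tclass (s : T) : tquot := \pi s.

Lemma tclassP s s' : tclass s = tclass s' <-> homologous s s'.
Proof.
by split=> [/eqmodP/asboolP|h]; last by apply/eqmodP/asboolP.
Qed.

Lemma tclass_repr x : tclass (repr x) = x.
Proof. exact: reprK. Qed.

Definition tquot_add (x y : tquot) := tclass (repr x ++ repr y).
Definition tquot_zero := tclass [::].
Definition tquot_scale (a : K) (x : tquot) := tclass (tscale a (repr x)).
Definition tquot_opp (x : tquot) := tquot_scale (-1) x.

Lemma tclass_add s s' : tquot_add (tclass s) (tclass s') = tclass (s ++ s').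
Proof. by apply/tclassP/homologous_cat; apply/tclassP/tclass_repr. Qed.

Lemma tclass_scale a s : tquot_scale a (tclass s) = tclass (tscale a s).
Proof. by apply/tclassP/homologous_scale; apply/tclassP/tclass_repr. Qed.

Lemma tclass_eq s s' : (forall (M : lmodType K) (f : L -> L -> M), bilin f ->
  \sum_(q <- s) f q.1 q.2 = \sum_(q <- s') f q.1 q.2) -> tclass s = tclass s'.
Proof. by move=> h; apply/tclassP/tensor_eq_homologous. Qed.

Lemma tquot_ind (P : tquot -> Prop) : (forall s, P (tclass s)) -> forall x, P x.
Proof. by move=> h x; rewrite -[x]tclass_repr. Qed.

Lemma tquot_addA : associative tquot_add.
Proof.
elim/tquot_ind=> x; elim/tquot_ind=> y; elim/tquot_ind=> z.
by rewrite !tclass_add catA.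
Qed.

Lemma tquot_addC : commutative tquot_add.
Proof.
elim/tquot_ind=> x; elim/tquot_ind=> y; rewrite !tclass_add.
by apply: tclass_eq => M f hf; rewrite !big_cat /= addrC.
Qed.

Lemma tquot_add0 : left_id tquot_zero tquot_add.
Proof. by elim/tquot_ind=> x; rewrite tclass_add. Qed.

Lemma tquot_addN : left_inverse tquot_zero tquot_opp tquot_add.
Proof.
elim/tquot_ind=> x; rewrite /tquot_opp tclass_scale tclass_add.
by apply: tclass_eq => M f hf; rewrite big_cat /= ev_scale // scaleN1r addNr big_nil.
Qed.

HB.instance Definition _ :=
  GRing.isZmodule.Build tquot tquot_addA tquot_addC tquot_add0 tquot_addN.

Lemma tquot_scaleA a b v : tquot_scale a (tquot_scale b v) = tquot_scale (a * b) v.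
Proof.
elim/tquot_ind: v => v; rewrite !tclass_scale; apply: tclass_eq => M f hf.
by rewrite !ev_scale // scalerA.
Qed.

Lemma tquot_scale1 : left_id 1 tquot_scale.
Proof.
elim/tquot_ind=> v; rewrite !tclass_scale; apply: tclass_eq => M f hf.
by rewrite !ev_scale // scale1r.
Qed.

Lemma tquot_scaleDr : right_distributive tquot_scale +%R.
Proof.
move=> a; elim/tquot_ind=> x; elim/tquot_ind=> y.
have addE s s' : tclass s + tclass s' = tclass (s ++ s') := tclass_add s s'.
rewrite addE !tclass_scale addE; apply: tclass_eq => M f hf.
by rewrite big_cat /= !ev_scale // big_cat scalerDr.
Qed.

Lemma tquot_scaleDl v : {morph tquot_scale^~ v : a b / a + b}.
Proof.
move=> a b; elim/tquot_ind: v => v; rewrite !tclass_scale [RHS]tclass_add.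
by apply: tclass_eq => M f hf; rewrite big_cat /= !ev_scale // scalerDl.
Qed.

HB.instance Definition _ := GRing.Zmodule_isLmodule.Build K tquot
  tquot_scaleA tquot_scale1 tquot_scaleDr tquot_scaleDl.

Lemma tclassD s s' : tclass s + tclass s' = tclass (s ++ s').
Proof. exact: tclass_add. Qed.

Lemma tclassZ a s : a *: tclass s = tclass (tscale a s).
Proof. exact: tclass_scale. Qed.

Definition tensor2 (x y : L) : tquot := tclass [:: (x, y)].

(** This is the tautological cocycle; its identity is the boundary of x (x) y (x) z. *)
Lemma tensor2_cocycle : cocycle br tensor2.
Proof.
split; first split=> a x y z.
- rewrite /tensor2 tclassZ tclassD; apply: tclass_eq => M f hf.
  by rewrite /= !big_cons !big_nil /= !addr0 hf.1 (bilinZl hf).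
- rewrite /tensor2 tclassZ tclassD; apply: tclass_eq => M f hf.
  by rewrite /= !big_cons !big_nil /= !addr0 hf.2 (bilinZl hf).
move=> x y z; rewrite /tensor2 -scaleN1r tclassZ tclassD; apply/tclassP.
exists [:: (x, y, z)] => M f hf.
rewrite big_cat /= !big_cons !big_nil /= !addr0 scaleN1r !(bilinNl hf).
by rewrite addrACA subrr add0r addKr.
Qed.

Lemma tensor2_sum s : \sum_(q <- s) tensor2 q.1 q.2 = tclass s.
Proof.
elim: s => [|[x y] s IH]; first by rewrite big_nil.
by rewrite big_cons IH [LHS]tclass_add.
Qed.

End TensorQuotient.

(** * The second homology *)

Lemma stl3_HL2 (K : comPzRingType) (R : algType K)
    (L : lmodType K) (br : L -> L -> L) (X : 'I_3 -> 'I_3 -> R -> L)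
    (hL : is_stl3 br X) (R3 : lmodType K) (bar : R -> R3)
    (hbar : is_R3_quotient bar) (psi : L -> L -> Umod R3)
    (hpsi : psi_spec br X bar psi) :
  HL2_iso br (Umod R3).
Proof.
have hb : bilin br by case: hL => -[].
have hc := psi_cocycle hL hbar hpsi; have [hp _] := hc.
have d2E s : delta2 br s = - \sum_(q <- s) br q.1 q.2 by rewrite /delta2 sumrN.
exists (fun s => \sum_(q <- s) psi q.1 q.2); split.
- by move=> s s' _ _; apply.
- by move=> s s' _ _; rewrite big_cat.
- by move=> a s _; apply: (ev_scale _ _ hp).
- apply: (psi_ind hL hbar hpsi).
  + by exists [::]; rewrite /delta2 !big_nil.
  + move=> k u v [s [ds <-]] [s' [ds' <-]]; exists (tscale k s ++ s').
    move: ds ds'; rewrite !d2E !big_cat /= !ev_scale // => /eqP; rewrite oppr_eq0 => /eqP ->.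
    by move/eqP; rewrite oppr_eq0 => /eqP ->; rewrite scaler0 addr0 oppr0.
  + by move=> x y xy; exists [:: (x, y)]; rewrite d2E !big_seq1 xy oppr0.
move=> s ds; split=> [ps|[w hw]]; last by rewrite hw // (ev_delta3_cocycle _ hc).
(* Summing the decomposition over a 2-cycle [s] writes its class as [al] of the sum of [psi] plus
   [g] of 0, so [s] is a boundary once that sum vanishes. *)
have [al [g [al_lin g_lin E]]] := cocycle_decomp hL hbar hpsi (tensor2_cocycle hb).
have : tclass hb s = tclass hb [::].
  have alS := big_morph al (klinearD al_lin) (klinear0 al_lin).
  have gS := big_morph g (klinearD g_lin) (klinear0 g_lin).
  rewrite -tensor2_sum; under eq_bigr do rewrite E.
  rewrite big_split /= -alS -gS ps (klinear0 al_lin) add0r.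
  by rewrite -[\sum_(q <- s) _]opprK -d2E ds oppr0 (klinear0 g_lin).
by move/tclassP.
Qed.

Theorem theorem4p4
  (K : comPzRingType) (R : algType K) (hR : free_with_one R)
  (L : lmodType K) (brL : L -> L -> L) (X : 'I_3 -> 'I_3 -> R -> L)
  (hL : is_stl3 brL X)
  (R3 : lmodType K) (bar : R -> R3) (hR3 : is_R3_quotient bar)
  (psi : L -> L -> Umod R3) (hpsi : psi_spec brL X bar psi) :
  leibniz (ext_bracket brL psi) /\
  universal_central_ext brL (ext_bracket brL psi) (@snd (Umod R3) L) /\
  HL2_iso brL (Umod R3).
Proof.
have hU := stl3_universal_central_ext hL hR3 hpsi.
by split; [case: hU => [[]] | split=> //; apply: stl3_HL2 hL _ _ hR3 _ hpsi].
Qed.
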